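(* Let $K$ be a unital commutative $\mathbb{Q}$-algebra and $W=\mathbb{N}^+$. Then the graded $K$-Hopf algebra homomorphism $\mathcal{T}_W:{\mathcal N}Sym\to\mathcal{H}_{GL}^W$ is injective.
   Context: ${\mathcal N}Sym$ is the free associative $K$-algebra on noncommuting generators $\Lambda_1,\Lambda_2,\dots$ (noncommutative symmetric functions), graded with $\Lambda_m$ of weight $m$ and with its standard Hopf structure; $\lambda(t)=1+\sum_{m\ge1}t^m\Lambda_m$. Trees: $W$-labeled rooted trees (vertices labeled by elements of $W$), isomorphisms preserving root and labels; $|T|$ sum of labels; $\alpha(T)=|\mathrm{Aut}(T)|$. $B_+(T_1,\dots,T_k)$ is obtained by adding a new root labeled $0$ (weight $0$) joined to the roots of the $T_i$; $\bar{\mathbb{T}}^W$ is the set of all such trees ($k\ge0$). $\mathcal{H}_{GL}^W$ is the Grossman–Larson Hopf algebra: $K$-span of $\bar{\mathbb{T}}^W$, product $B_+(T_1,\dots,T_k)\cdot S$ = sum of all trees obtained by joining each root of $T_1,\dots,T_k$ by an edge to some vertex of $S$, unit $B_+()$, coproduct $\Delta B_+(T_1,\dots,T_k)=\sum_{I\sqcup J=\{1..k\}}B_+(T_I)\otimes B_+(T_J)$, graded by $|T|$. $\mathcal{T}_W$ is the $K$-algebra homomorphism with $\mathcal{T}_W(\lambda(t))=\sum t^{|T|}(-1)^{o(T)}T/\alpha(T)$ (coefficientwise), the sum over $T\in\bar{\mathbb{T}}^W$ all of whose non-root vertices are children of the root, $o(T)$ the number of children of the root; it is known to be a graded Hopf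 algebra homomorphism. *)

(* Defs.v *)
From HB Require Import structures.
From mathcomp Require Import all_boot all_order all_algebra.
From mathcomp Require Import perm generic_quotient finmap.
From mathcomp.multinomials Require Import monalg.

Set Implicit Arguments.
Unset Strict Implicit.
Unset Printing Implicit Defensive.

Import GRing.Theory.
Local Open Scope ring_scope.
Local Open Scope quotient_scope.

Notation posN := {n : nat | (0 < n)%N}.

(* A tree B_+(T_1, ..., T_k), where the T_i are trees labeled by positive
   integers, and V is the set of the vertices other than the added root. The
   vertices are the elements of option V: None is the added root (labeled 0),
   and btree_val is the pair of the parent function and of the labeling of V.
   The condition says that None is an ancestor of every vertex. *)
Record btree (V : finType) := BTree {
  btree_val : {ffun V -> option V} * {ffun V -> posN};
  _ : [forall x, fconnect (obind btree_val.1) (Some x) None] }.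

HB.instance Definition _ V := [isSub for @btree_val V].
HB.instance Definition _ V := [Choice of btree V by <:].

Section Trees.
Variable V : finType.
Implicit Type T : btree V.

Definition up T : {ffun V -> option V} := (val T).1.
Definition lab T : {ffun V -> posN} := (val T).2.
Definition top T := {x : V | up T x == None}.

Definition weight T : nat := \sum_x val (lab T x).
(* The number of children of the root. *)
Definition nchildren T : nat := #|[set x | up T x == None]|.
(* Every non-root vertex is a child of the root. *)
Definition is_shrub T : bool := [forall x, up T x == None].

(* An automorphism fixes the root None, so it is a permutation of V. *)
Definition tree_aut T : {set {perm V}} :=
  [set s : {perm V} | [forall x, (up T (s x) == omap s (up T x))
                              && (lab T (s x) == lab T x)]].
Definition alpha T : nat := #|tree_aut T|.

Lemma up_acyclic T x : fconnect (obind (up T)) (Some x) None.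
Proof. by case: T => p pP; exact: (forallP pP). Qed.

End Trees.

Definition iso (V V' : finType) (T : btree V) (T' : btree V') : bool :=
  [exists f : {ffun V -> V'}, exists g : {ffun V' -> V},
    [&& [forall x, g (f x) == x], [forall y, f (g y) == y],
        [forall x, up T' (f x) == omap f (up T x)]
      & [forall x, lab T' (f x) == lab T x]]].

Lemma isoP (V V' : finType) (T : btree V) (T' : btree V') :
  reflect (exists f : V -> V', exists g : V' -> V,
             [/\ cancel f g, cancel g f,
                 forall x, up T' (f x) = omap f (up T x)
               & forall x, lab T' (f x) = lab T x])
          (iso T T').
Proof.
apply: (iffP existsP) => [[f /existsP[g /and4P[]]]|[f [g [fK gK fU fL]]]].
  move=> /forallP fK /forallP gK /forallP fU /forallP fL.
  by exists f, g; split=> x; apply/eqP.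
exists [ffun x => f x]; apply/existsP; exists [ffun x => g x].
apply/and4P; split; apply/forallP=> x; rewrite !ffunE ?fK ?gK ?fL //.
by rewrite fU; case: (up T x) => //= y; rewrite ffunE.
Qed.

Lemma iso_refl V (T : btree V) : iso T T.
Proof. by apply/isoP; exists id, id; split=> // x; case: (up T x). Qed.

Lemma iso_sym_imp V V' (T : btree V) (T' : btree V') : iso T T' -> iso T' T.
Proof.
case/isoP=> f [g [fK gK fU fL]]; apply/isoP; exists g, f; split=> // y.
  by rewrite -{2}[y]gK fU; case: (up T _) => //= z; rewrite fK.
by rewrite -fL gK.
Qed.

Lemma iso_sym V V' (T : btree V) (T' : btree V') : iso T T' = iso T' T.
Proof. by apply/idP/idP; apply: iso_sym_imp. Qed.

Lemma iso_trans V1 V2 V3 (T1 : btree V1) (T2 : btree V2) (T3 : btree V3) :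
  iso T1 T2 -> iso T2 T3 -> iso T1 T3.
Proof.
case/isoP=> f [g [fK gK fU fL]] /isoP[h [k [hK kK hU hL]]].
apply/isoP; exists (h \o f), (g \o k); split=> x /=; rewrite ?hK ?gK //.
- by rewrite hU fU; case: (up T1 x).
- by rewrite hL fL.
Qed.

Definition rtree := {n : nat & btree 'I_n}.
Definition rtree_iso (T T' : rtree) : bool := iso (tagged T) (tagged T').

Lemma rtree_iso_refl : reflexive rtree_iso.
Proof. by move=> T; apply: iso_refl. Qed.
Lemma rtree_iso_sym : symmetric rtree_iso.
Proof. by move=> T T'; apply: iso_sym. Qed.
Lemma rtree_iso_trans : transitive rtree_iso.
Proof. by move=> T2 T1 T3; apply: iso_trans. Qed.

Canonical rtree_equiv :=
  EquivRel rtree_iso rtree_iso_refl rtree_iso_sym rtree_iso_trans.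

(* \bar{T}^W for W = N^+, a tree being taken up to isomorphism. *)
Definition tbar := {eq_quot rtree_iso}.
HB.instance Definition _ := Choice.on tbar.
HB.instance Definition _ := EqQuotient.on tbar.

Lemma tbarP (T T' : rtree) :
  reflect (\pi_tbar T = \pi_tbar T') (rtree_iso T T').
Proof. exact: eqquotP. Qed.

Definition nv (T : tbar) : nat := tag (repr T).
Definition tree_of (T : tbar) : btree 'I_(nv T) := tagged (repr T).

Section Class.
Variables (V : finType) (T : btree V).

Definition cls_val : {ffun 'I_#|V| -> option 'I_#|V|} * {ffun 'I_#|V| -> posN} :=
  ([ffun i => omap enum_rank (up T (enum_val i))],
   [ffun i => lab T (enum_val i)]).

Lemma cls_subproof :
  [forall i, fconnect (obind cls_val.1) (Some i) None].
Proof.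
apply/forallP=> i; rewrite -[i]enum_valK.
have iterE k z : iter k (obind cls_val.1) (omap enum_rank z)
               = omap enum_rank (iter k (obind (up T)) z).
  elim: k => //= k ->; case: (iter _ _ _) => //= x.
  by rewrite ffunE enum_rankK.
have := iter_findex (up_acyclic T (enum_val i)).
set k := findex _ _ _ => kE.
have := iterE k (Some (enum_val i)); rewrite kE /= => <-.
exact: fconnect_iter.
Qed.

Definition cls : tbar :=
  \pi_tbar (Tagged (fun n => btree 'I_n) (BTree cls_subproof)).

Lemma iso_tree_of_cls : iso (tree_of cls) T.
Proof.
have: rtree_iso (repr cls) (Tagged (fun n => btree 'I_n) (BTree cls_subproof)).
  by apply/tbarP; rewrite reprK.
rewrite /rtree_iso /= => /iso_trans; apply.
apply/isoP; exists enum_val, enum_rank; split=> [i|x|i|i].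
- exact: enum_valK.
- exact: enum_rankK.
- rewrite [up (BTree _)]/up /= ffunE; case: (up T _) => //= x.
  by rewrite enum_rankK.
- by rewrite [lab (BTree _)]/lab /= ffunE.
Qed.

End Class.

Lemma cls_eqP V V' (T : btree V) (T' : btree V') :
  reflect (cls T = cls T') (iso T T').
Proof.
apply: (iffP idP) => [isoT|eqT].
  rewrite -[cls T]reprK -[cls T']reprK; apply/tbarP.
  apply: iso_trans (iso_tree_of_cls T) _; apply: iso_trans isoT _.
  by rewrite iso_sym; apply: iso_tree_of_cls.
apply: iso_trans (iso_tree_of_cls T'); rewrite -eqT iso_sym.
exact: iso_tree_of_cls.
Qed.

Lemma tree_ofK (T : tbar) : cls (tree_of T) = T.
Proof.
by rewrite -[LHS]reprK -[RHS]reprK; apply/tbarP/iso_tree_of_cls.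
Qed.

(* weight, nchildren, is_shrub and alpha only depend on the class. *)
Section Invariance.
Variables (V V' : finType) (T : btree V) (T' : btree V') (TT' : iso T T').

Lemma weight_iso : weight T = weight T'.
Proof.
have [f [g [fK gK _ fL]]] := isoP _ _ TT'.
rewrite /weight [RHS](reindex f); last by exists g => x _.
by apply: eq_bigr => x _; rewrite fL.
Qed.

Lemma nchildren_iso : nchildren T = nchildren T'.
Proof.
have [f [g [fK gK fU _]]] := isoP _ _ TT'.
rewrite /nchildren -(card_imset _ (can_inj fK)); apply: eq_card => y.
rewrite -[y]gK mem_imset; last exact: can_inj fK.
by rewrite !inE fU; case: (up T _).
Qed.

Lemma is_shrub_iso : is_shrub T = is_shrub T'.
Proof.
have [f [g [fK gK fU _]]] := isoP _ _ TT'.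
apply/forallP/forallP => sh x; last by have := sh (f x); rewrite fU; case: (up T x).
by rewrite -[x]gK fU (eqP (sh (g x))).
Qed.

Lemma alpha_iso : alpha T = alpha T'.
Proof.
have [f [g [fK gK fU fL]]] := isoP _ _ TT'.
have gU y : up T (g y) = omap g (up T' y).
  by rewrite -{2}[y]gK fU; case: (up T _) => //= z; rewrite fK.
have gL y : lab T (g y) = lab T' y by rewrite -fL gK.
have inj_t (s : {perm V}) : injective (f \o s \o g).
  move=> x y /= /(can_inj fK)/perm_inj; exact: (can_inj gK).
pose t (s : {perm V}) := perm (inj_t s).
have inj_tt : injective t.
  move=> s1 s2 /permP e; apply/permP=> x.
  by have := e (f x); rewrite !permE /= fK => /(can_inj fK).
rewrite /alpha -(card_imset _ inj_tt); apply: eq_card => s'.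
apply/imsetP/idP => [[s] | ].
  rewrite inE => /forallP sA ->; rewrite inE; apply/forallP=> y.
  have /andP[/eqP sU /eqP sL] := sA (g y).
  rewrite !permE /= fU fL sU sL gL eqxx andbT gU.
  by case: (up T' y) => //= z; rewrite permE.
rewrite inE => /forallP sA.
have inj_s : injective (g \o s' \o f).
  move=> x y /= /(can_inj gK)/perm_inj; exact: (can_inj fK).
exists (perm inj_s); last by apply/permP=> y; rewrite !permE /= permE /= !gK.
rewrite inE; apply/forallP=> x; have /andP[/eqP sU /eqP sL] := sA (f x).
rewrite permE /= gU gL sU sL fL eqxx andbT fU.
by case: (up T x) => //= z; rewrite permE.
Qed.

End Invariance.

(* The tree obtained from T and S by removing the root of T and joining each
   child x of this root to the vertex f x of S. *)
Section Graft.
Variables (V V' : finType) (T : btree V) (S : btree V').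
Variable f : {ffun top T -> option V'}.

Definition attach (x : V) : option V' := obind f (insub x).

Definition graft_up (z : V + V') : option (V + V') :=
  match z with
  | inl x => if up T x is Some y then Some (inl y) else omap inr (attach x)
  | inr y => omap inr (up S y)
  end.

Definition graft_lab (z : V + V') : posN :=
  match z with inl x => lab T x | inr y => lab S y end.

Definition graft_val : {ffun V + V' -> option (V + V')} * {ffun V + V' -> posN} :=
  ([ffun z => graft_up z], [ffun z => graft_lab z]).

Lemma graft_subproof : [forall z, fconnect (obind graft_val.1) (Some z) None].
Proof.
apply/forallP.
have cS (y : option V') : fconnect (obind graft_val.1) (omap inr y) None.
  case: y => [y|]; last exact: connect0.
  have iterE k z : iter k (obind graft_val.1) (omap inr z)
                 = omap inr (iter k (obind (up S)) z).
    elim: k => //= k ->; case: (iter _ _ _) => //= x.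
    by rewrite ffunE.
  have := iter_findex (up_acyclic S y).
  set k := findex _ _ _ => kE.
  have := iterE k (Some y); rewrite kE /= => <-.
  exact: fconnect_iter.
case=> [x|y]; last exact: (cS (Some y)).
have := iter_findex (up_acyclic T x); move: (findex _ _ _) => k.
elim: k x => [|k IH] x //; rewrite iterSr /=.
have step : fconnect (obind graft_val.1) (Some (inl x)) (graft_up (inl x)).
  by apply: connect1; rewrite /= ffunE.
move=> kE; apply: connect_trans step _ => /=.
by case: (up T x) kE => [y /IH|_].
Qed.

Definition graft : btree (V + V')%type := BTree graft_subproof.

End Graft.

(* The Grossman-Larson product of two trees. *)
Definition glmulT (K : nzRingType) (T S : tbar) : {malg K[tbar]} :=
  \sum_(f : {ffun top (tree_of T) -> option 'I_(nv S)})
     << cls (graft (tree_of S) f) >>.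

(* glmulT can be computed on arbitrary representatives. *)
Section GraftTheory.

Lemma graft_upE V V' (T : btree V) (S : btree V') f z :
  up (graft (T := T) S f) z = graft_up S f z.
Proof. by rewrite /up /= ffunE. Qed.

Lemma graft_labE V V' (T : btree V) (S : btree V') f z :
  lab (graft (T := T) S f) z = graft_lab T S z.
Proof. by rewrite /lab /= ffunE. Qed.

(* Functions on the children of the root, extended by None. *)
Definition supp_top V (T : btree V) (A : eqType) (f : {ffun V -> option A}) :=
  [forall x, (up T x != None) ==> (f x == None)].

Lemma supp_topP V (T : btree V) (A : eqType) (f : {ffun V -> option A}) :
  reflect (forall x y, up T x = Some y -> f x = None) (supp_top T f).
Proof.
apply: (iffP forallP) => [h x y e|h x].
  by have /implyP := h x; rewrite e => /(_ isT)/eqP.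
by apply/implyP; case e : (up T x) => // _; rewrite (h _ _ e).
Qed.

Definition restr_top V (T : btree V) A (f : {ffun V -> A}) : {ffun top T -> A} :=
  [ffun u => f (val u)].

Lemma attach_restr V (V' : finType) (T : btree V) (f : {ffun V -> option V'}) x :
  up T x = None -> attach (restr_top T f) x = f x.
Proof.
by move=> /eqP xT; rewrite /attach insubT /= ffunE.
Qed.

Lemma sum_restr (M : nmodType) V (V' : finType) (T : btree V)
    (F : {ffun top T -> option V'} -> M) :
  \sum_f F f = \sum_(f | supp_top T f) F (restr_top T f).
Proof.
rewrite [LHS](reindex_onto (@restr_top V T (option V'))
                           (fun f => [ffun x => attach f x])); last first.
  move=> f _; apply/ffunP=> u; rewrite !ffunE /attach insubT ?(valP u) //= => p.
  by congr (f _); apply: val_inj.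
apply: eq_bigl => f /=; apply/eqP/supp_topP => [<- x y e|fP].
  by rewrite ffunE /attach insubF // e.
apply/ffunP=> x; rewrite ffunE; case e : (up T x) => [y|].
  by rewrite (fP _ _ e) /attach insubF // e.
by rewrite attach_restr.
Qed.

Variable K : nzRingType.

Definition glsum V V' (T : btree V) (S : btree V') : {malg K[tbar]} :=
  \sum_(f : {ffun top T -> option V'}) << cls (graft S f) >>.

Lemma glsum_iso V1 V2 V1' V2' (T1 : btree V1) (T2 : btree V2)
    (S1 : btree V1') (S2 : btree V2') :
  iso T1 T2 -> iso S1 S2 -> glsum T1 S1 = glsum T2 S2.
Proof.
case/isoP=> f [g [fK gK fU fL]] /isoP[h [k [hK kK hU hL]]].
rewrite /glsum !sum_restr.
pose H (p : {ffun V1 -> option V1'}) := [ffun x => omap h (p (g x))].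
pose H' (p : {ffun V2 -> option V2'}) := [ffun x => omap k (p (f x))].
rewrite [RHS](reindex H); last first.
  exists H' => p _; apply/ffunP=> x; rewrite !ffunE.
    by rewrite fK; case: (p _) => //= y; rewrite hK.
  by rewrite gK; case: (p _) => //= y; rewrite kK.
apply: eq_big => p.
  apply/supp_topP/supp_topP => pP x y e.
    rewrite ffunE (pP _ (g y)) //; move: e; rewrite -{1}[x]gK fU.
    by case: (up T1 _) => //= z [<-]; rewrite fK.
  have := pP (f x) (f y); rewrite fU e ffunE fK => /(_ erefl).
  by case: (p x).
move=> _; congr << _ >>; apply/cls_eqP/isoP.
exists (fun z => match z with inl x => inl (f x) | inr y => inr (h y) end).
exists (fun z => match z with inl x => inl (g x) | inr y => inr (k y) end).
split=> [[x|y]|[x|y]|[x|y]|[x|y]]; rewrite ?fK ?gK ?hK ?kK //.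
- rewrite !graft_upE /= fU; case e : (up T1 x) => [y|] //=.
  rewrite !attach_restr ?fU ?e //= ffunE fK.
  by case: (p x).
- by rewrite !graft_upE /= hU; case: (up S1 y).
- by rewrite !graft_labE /= fL.
- by rewrite !graft_labE /= hL.
Qed.

Lemma glmulT_cls V V' (T : btree V) (S : btree V') :
  glmulT K (cls T) (cls S) = glsum T S.
Proof. by apply: glsum_iso; apply: iso_tree_of_cls. Qed.

Lemma glsumA V V' V'' (T : btree V) (S : btree V') (U : btree V'') :
  \sum_(f : {ffun top T -> option V'}) glsum (graft S f) U =
  \sum_(h : {ffun top S -> option V''}) glsum T (graft U h).
Proof.
rewrite [LHS]sum_restr [RHS]sum_restr /glsum.
under eq_bigr do rewrite sum_restr.
under [RHS]eq_bigr do rewrite sum_restr.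
rewrite !pair_big_dep /=.
pose toF (q : {ffun V' -> option V''} * {ffun V -> option (V' + V'')}) :=
  ([ffun x => if q.2 x is Some (inl y) then Some y else None],
   [ffun z => match z with
      | inl x => if q.2 x is Some (inr t) then Some t else None
      | inr y => q.1 y end])
  : {ffun V -> option V'} * {ffun V + V' -> option V''}.
pose toH (q : {ffun V -> option V'} * {ffun V + V' -> option V''}) :=
  ([ffun y => q.2 (inr y)],
   [ffun x => if q.1 x is Some y then Some (inl y) else omap inr (q.2 (inl x))])
  : {ffun V' -> option V''} * {ffun V -> option (V' + V'')}.
rewrite [LHS](reindex_onto toF toH) /=; last first.
  move=> [f g] /= /andP[/supp_topP fP /supp_topP gP]; congr (_, _).
    by apply/ffunP=> x; rewrite !ffunE; case: (f x) => //=; case: (g _).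
  apply/ffunP=> -[x|y]; rewrite !ffunE //.
  case e: (f x) => [y|] /=; last by case: (g _).
  have xT : up T x = None by case e': (up T x) => [z|] //; rewrite (fP _ _ e') in e.
  by rewrite (gP (inl x) (inr y)) // graft_upE /= xT attach_restr // e.
apply: eq_big => [[h k]|[h k]] /=.
  have -> : toH (toF (h, k)) = (h, k).
    congr (_, _); apply/ffunP=> x; rewrite !ffunE //=.
    by case: (k x) => [[]|].
  rewrite eqxx andbT; apply/andP/andP=> -[/supp_topP fP /supp_topP gP]; split.
  - apply/supp_topP=> x y e; have := gP (inr x) (inr y).
    by rewrite graft_upE /= e ffunE; apply.
  - apply/supp_topP=> x y e; have := fP _ _ e; rewrite ffunE.
    have := gP (inl x) (inl y); rewrite graft_upE /= e ffunE => /(_ erefl).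
    by case: (k x) => [[]|].
  - by apply/supp_topP=> x y e; rewrite ffunE (gP _ _ e).
  - apply/supp_topP=> -[x|x] y; rewrite graft_upE /= ffunE.
      case e: (up T x) => [z|]; first by rewrite (gP _ _ e).
      by rewrite attach_restr // ffunE; case: (k x) => [[]|].
    by case e: (up S x) => [z|] // _; rewrite (fP _ _ e).
move=> _; congr << _ >>; apply/cls_eqP/isoP.
exists (fun z => match z with
  | inl (inl x) => inl x | inl (inr y) => inr (inl y)
  | inr t => inr (inr t) end).
exists (fun z => match z with
  | inl x => inl (inl x) | inr (inl y) => inl (inr y)
  | inr (inr t) => inr t end).
split; first by case=> [[]|].
- by case=> [|[]].
- case=> [[x|y]|t]; last 1 first.
  + by rewrite !graft_upE /= graft_upE /=; case: (up U t).
  + rewrite [RHS]/omap /= !graft_upE /= !graft_upE /=.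
    case e: (up T x) => [z|] //=.
    rewrite !(attach_restr (T := T)) // ffunE.
    case e': (k x) => [[y|t]|] //=;
      rewrite attach_restr ?graft_upE /= ?e ?attach_restr //;
      by rewrite ffunE e'.
  + rewrite !graft_upE /= !graft_upE /=.
    case e: (up S y) => [z|] //=.
    rewrite !attach_restr // ?graft_upE /= ?e // !ffunE.
    by case: (h y).
by case=> [[x|y]|t]; rewrite !graft_labE /= ?graft_labE.
Qed.

End GraftTheory.

(* The Grossman-Larson algebra: the free K-module on tbar, with the bilinear
   extension of glmulT. *)
Definition HGL (K : comNzRingType) := {malg K[tbar]}.
HB.instance Definition _ (K : comNzRingType) := GRing.Lmodule.on (HGL K).

(* The tree B_+(). *)
Lemma btree0_subproof :
  [forall x : void,
     fconnect (obind ([ffun=> None] : {ffun void -> option void})) (Some x) None].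
Proof. by apply/forallP=> -[]. Qed.
Definition btree0 : btree void :=
  @BTree void ([ffun=> None], [ffun x : void => match x with end])
    btree0_subproof.

Section GrossmanLarson.
Variable K : comNzRingType.
Implicit Types x y z : HGL K.

Definition glone : HGL K := << cls btree0 >>.
Definition glmul x y : HGL K :=
  \sum_(T <- msupp x) \sum_(S <- msupp y) (x@_T * y@_S) *: glmulT K T S.

Definition lin (M : lmodType K) (h : tbar -> M) x : M :=
  \sum_(T <- msupp x) x@_T *: h T.

Lemma linEw (M : lmodType K) (h : tbar -> M) x (d : {fset tbar}) :
  (msupp x `<=` d)%fset -> lin h x = \sum_(T <- d) x@_T *: h T.
Proof.
move=> xd; rewrite /lin; apply: big_fset_incl => // T _.
by move=> /mcoeff_outdom ->; rewrite scale0r.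
Qed.

Lemma lin_is_linear (M : lmodType K) (h : tbar -> M) : linear (lin h).
Proof.
move=> a x y; pose d := (msupp x `|` msupp y)%fset.
rewrite (@linEw _ _ (a *: x + y) d); last first.
  apply: fsubset_trans (msuppD_le _ _) _.
  by apply: fsetUSS => //; apply: msuppZ_le.
rewrite (@linEw _ _ x d) ?fsubsetUl // (@linEw _ _ y d) ?fsubsetUr //.
rewrite scaler_sumr -big_split /=; apply: eq_bigr => T _.
by rewrite mcoeffD mcoeffZ scalerDl scalerA.
Qed.

Lemma lin_basis (M : lmodType K) (h : tbar -> M) T : lin h << T >> = h T.
Proof.
rewrite (@linEw _ _ << T >> [fset T]%fset); last exact: msuppU_le.
by rewrite big_seq_fset1 mcoeffUU scale1r.
Qed.

Lemma malgU_scale (I : choiceType) (a : K) (i : I) :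
  << a *g i >> = a *: << i >> :> {malg K[I]}.
Proof. by apply/malgP=> j; rewrite mcoeffZ !mcoeffU mulr_natr. Qed.

Lemma basisE x : x = \sum_(T <- msupp x) x@_T *: (<< T >> : HGL K).
Proof.
by rewrite {1}[x]monalgE; apply: eq_bigr => T _; rewrite malgU_scale.
Qed.

Lemma glmul_linl x y : glmul x y = lin (fun T => lin (glmulT K T) y) x.
Proof.
apply: eq_bigr => T _; rewrite /lin scaler_sumr; apply: eq_bigr => S _.
by rewrite scalerA.
Qed.

Lemma glmul_linr x y : glmul x y = lin (fun S => lin (glmulT K ^~ S) x) y.
Proof.
rewrite /glmul exchange_big; apply: eq_bigr => T _.
rewrite /lin scaler_sumr; apply: eq_bigr => S _.
by rewrite scalerA mulrC.
Qed.

Lemma glmulDl : left_distributive glmul +%R.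
Proof.
by move=> x y z; rewrite !glmul_linl -[x]scale1r lin_is_linear !scale1r.
Qed.

Lemma glmulDr : right_distributive glmul +%R.
Proof.
by move=> x y z; rewrite !glmul_linr -[y]scale1r lin_is_linear !scale1r.
Qed.

Lemma lin0 (M : lmodType K) (h : tbar -> M) : lin h 0 = 0.
Proof. by rewrite /lin msupp0 big_seq_fset0. Qed.

Lemma glmulZl a x y : glmul (a *: x) y = a *: glmul x y.
Proof.
by rewrite !glmul_linl -[a *: x]addr0 lin_is_linear lin0 addr0.
Qed.

Lemma glmulZr a x y : glmul x (a *: y) = a *: glmul x y.
Proof.
by rewrite !glmul_linr -[a *: y]addr0 lin_is_linear lin0 addr0.
Qed.

Lemma glmul0l y : glmul 0 y = 0.
Proof. by rewrite glmul_linl lin0. Qed.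
Lemma glmul0r x : glmul x 0 = 0.
Proof. by rewrite glmul_linr lin0. Qed.

Lemma glmul_suml I (r : seq I) (P : pred I) (F : I -> HGL K) y :
  glmul (\sum_(i <- r | P i) F i) y = \sum_(i <- r | P i) glmul (F i) y.
Proof.
by apply: (big_morph (glmul^~ y)) => [a b|]; rewrite ?glmulDl ?glmul0l.
Qed.

Lemma glmul_sumr I (r : seq I) (P : pred I) (F : I -> HGL K) x :
  glmul x (\sum_(i <- r | P i) F i) = \sum_(i <- r | P i) glmul x (F i).
Proof.
by apply: (big_morph (glmul x)) => [a b|]; rewrite ?glmulDr ?glmul0r.
Qed.

Lemma glmul_basis T S : glmul << T >> << S >> = glmulT K T S.
Proof. by rewrite glmul_linl !lin_basis. Qed.

Lemma glmul_cls V V' (T : btree V) (S : btree V') :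
  glmul << cls T >> << cls S >> = glsum K T S.
Proof. by rewrite glmul_basis glmulT_cls. Qed.

Lemma HGL_ind (P : HGL K -> Prop) :
  P 0 -> (forall a x y, P x -> P y -> P (a *: x + y)) ->
  (forall T, P << T >>) -> forall x, P x.
Proof.
move=> P0 PD PU x; rewrite [x]basisE.
by elim/big_rec: _ => // T y _; apply: PD.
Qed.

Lemma bilinear_assoc (op : HGL K -> HGL K -> HGL K) :
  left_distributive op +%R -> right_distributive op +%R ->
  (forall a x y, op (a *: x) y = a *: op x y) ->
  (forall a x y, op x (a *: y) = a *: op x y) ->
  (forall T S U,
     op << T >> (op << S >> << U >>) = op (op << T >> << S >>) << U >>) ->
  associative op.
Proof.
move=> opDl opDr opZl opZr opU.
have op0l x : op 0 x = 0 by have := opZl 0 0 x; rewrite !scale0r.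
have op0r x : op x 0 = 0 by have := opZr 0 x 0; rewrite !scale0r.
move=> x y z; elim/HGL_ind: x => [|a x1 x2 IH1 IH2|T].
- by rewrite !op0l.
- by rewrite !(opDl, opZl) IH1 IH2.
elim/HGL_ind: y => [|a y1 y2 IH1 IH2|S].
- by move: << T >> => t; rewrite op0l !op0r op0l.
- move: << T >> IH1 IH2 => t IH1 IH2.
  by rewrite opDl opZl !opDr !opZr IH1 IH2 opDl opZl.
elim/HGL_ind: z => [|a z1 z2 IH1 IH2|U]; last exact: opU.
- by move: << T >> << S >> => t s; rewrite !op0r.
- move: << T >> << S >> IH1 IH2 => t s IH1 IH2.
  by rewrite !(opDr, opZr) IH1 IH2.
Qed.

Lemma glmulA : associative glmul.
Proof.
apply: bilinear_assoc glmulDl glmulDr glmulZl glmulZr _ => T S U.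
have /= := glsumA K (tree_of T) (tree_of S) (tree_of U).
have -> : \sum_(f : {ffun top (tree_of T) -> option 'I_(nv S)})
            glsum K (graft (tree_of S) f) (tree_of U)
        = glmul (glmul << T >> << S >>) << U >>.
  rewrite (glmul_basis T S) [RHS]glmul_suml; apply: eq_bigr => f _.
  by rewrite -glmul_cls tree_ofK.
have -> : \sum_(h : {ffun top (tree_of S) -> option 'I_(nv U)})
            glsum K (tree_of T) (graft (tree_of U) h)
        = glmul << T >> (glmul << S >> << U >>).
  rewrite [X in glmul _ X](glmul_basis S U) [RHS]glmul_sumr; apply: eq_bigr => h _.
  by rewrite -glmul_cls tree_ofK.
by [].
Qed.

Lemma glmul1l : left_id glone glmul.
Proof.
move=> x; elim/HGL_ind: x => [|a x1 x2 IH1 IH2|S].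
- by rewrite glmul0r.
- by rewrite glmulDr glmulZr IH1 IH2.
rewrite -[S]tree_ofK glmul_cls /glsum sum_restr.
pose f0 : {ffun void -> option 'I_(nv S)} := [ffun=> None].
rewrite (big_pred1 f0) => [|f] /=; last first.
  have -> : f = f0 by apply/ffunP=> -[].
  by rewrite eqxx; apply/forallP=> -[].
congr << _ >>; apply/cls_eqP; rewrite iso_sym; apply/isoP.
exists inr, (fun z : (void + _)%type =>
  match z with inl x => match x with end | inr y => y end).
split; first by [].
- by case=> [[]|].
- by move=> y; rewrite graft_upE.
- by move=> y; rewrite graft_labE.
Qed.

Lemma glmul1r : right_id glone glmul.
Proof.
move=> x; elim/HGL_ind: x => [|a x1 x2 IH1 IH2|T].
- by rewrite glmul0l.
- by rewrite glmulDl glmulZl IH1 IH2.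
rewrite -[T]tree_ofK glmul_cls /glsum sum_restr.
pose f0 : {ffun 'I_(nv T) -> option void} := [ffun=> None].
rewrite (big_pred1 f0) => [|f] /=; last first.
  have -> : f = f0 by apply/ffunP=> x; rewrite ffunE; case: (f x) => [[]|].
  by rewrite eqxx; apply/supp_topP=> y z _; rewrite ffunE.
congr << _ >>; apply/cls_eqP; rewrite iso_sym; apply/isoP.
exists inl, (fun z : (_ + void)%type =>
  match z with inl x => x | inr y => match y with end end).
split; first by [].
- by case=> [|[]].
- move=> x; rewrite graft_upE /=; case e: (up _ x) => [y|] //=.
  by rewrite attach_restr // ffunE.
- by move=> y; rewrite graft_labE.
Qed.

Lemma glone_neq0 : glone != 0.
Proof. by rewrite monalgU_eq0 oner_eq0. Qed.

HB.instance Definition _ := GRing.Zmodule_isNzRing.Build (HGL K)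
  glmulA glmul1l glmul1r glmulDl glmulDr glone_neq0.

Lemma glscaleAl (a : K) (x y : HGL K) : a *: (x * y) = (a *: x) * y.
Proof. by rewrite -[RHS]/(glmul _ _) glmulZl. Qed.
HB.instance Definition _ := GRing.Lmodule_isLalgebra.Build K (HGL K) glscaleAl.

Lemma glscaleAr (a : K) (x y : HGL K) : a *: (x * y) = x * (a *: y).
Proof. by rewrite -[RHS]/(glmul _ _) glmulZr. Qed.
HB.instance Definition _ := GRing.Lalgebra_isAlgebra.Build K (HGL K) glscaleAr.

End GrossmanLarson.

(* NSym: the monoid algebra of the free monoid on the positive integers. *)
Definition NSym (K : comNzRingType) := {malg K[{fmonom posN}]}.
HB.instance Definition _ (K : comNzRingType) := GRing.Lalgebra.on (NSym K).

(* The coefficient of t^m in lambda(t). *)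
Definition Lambda (K : comNzRingType) (m : nat) : NSym K :=
  if insub m is Some i then << fmu (i : posN) >> else 1.

Section Shrubs.

Lemma shrub_subproof (V : finType) (l : {ffun V -> posN}) :
  [forall x, fconnect (obind ([ffun=> None] : {ffun V -> option V}))
                      (Some x) None].
Proof. by apply/forallP=> x; apply: connect1; rewrite /= ffunE. Qed.

Definition shrub (V : finType) (l : {ffun V -> posN}) : btree V :=
  @BTree V ([ffun=> None], l) (shrub_subproof l).

Lemma shrubP (V : finType) (T : btree V) : is_shrub T -> T = shrub (lab T).
Proof.
move=> /forallP sT; apply: val_inj; rewrite [LHS]surjective_pairing.
by congr (_, _); apply/ffunP=> x; rewrite ffunE; apply/eqP/sT.
Qed.

Definition succ_posN (m : nat) (i : 'I_m) : posN := exist _ i.+1 isT.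

Definition shrub_class (n m : nat) (l : {ffun 'I_n -> 'I_m}) : tbar :=
  cls (shrub [ffun x => succ_posN (l x)]).

(* All the shrubs of weight m; see mem_shrubs. *)
Definition shrubs (m : nat) : seq tbar :=
  undup [seq T <- [seq shrub_class l
                     | n <- iota 0 m.+1, l <- enum {: {ffun 'I_n -> 'I_m}}]
           | weight (tree_of T) == m].

Lemma mem_shrubs m T :
  (T \in shrubs m) = is_shrub (tree_of T) && (weight (tree_of T) == m).
Proof.
rewrite mem_undup mem_filter andbC; case: eqP => [wT|]; last by rewrite !andbF.
rewrite !andbT; apply/allpairsPdep/idP => [[n [l [_ _ ->]]]|sT].
  rewrite (is_shrub_iso (iso_tree_of_cls _)).
  by apply/forallP=> x; rewrite /up /= ffunE.
have leW x : (val (lab (tree_of T) x) <= m)%N.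
  by rewrite -wT /weight (bigD1 x) //= leq_addr.
have nvT : (nv T < m.+1)%N.
  rewrite ltnS -wT -[X in (X <= _)%N]card_ord -sum1_card leq_sum // => x _.
  exact: (valP (lab _ x)).
have ltW x : ((val (lab (tree_of T) x)).-1 < m)%N.
  by rewrite prednK ?leW //; apply: (valP (lab _ x)).
exists (nv T), [ffun x => Ordinal (ltW x)]; split.
- by rewrite mem_iota.
- by rewrite mem_enum.
rewrite /shrub_class -[LHS]tree_ofK {1}(shrubP sT); congr (cls (shrub _)).
apply/ffunP=> x; rewrite !ffunE; apply: val_inj => /=.
by rewrite prednK //; apply: (valP (lab _ x)).
Qed.

End Shrubs.

Section TW.
Variable K : comAlgType rat.

(* The coefficient of t^m in the sum of t^|T| (-1)^o(T) T / alpha(T). *)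
Definition TWcoef (m : nat) : HGL K :=
  \sum_(T <- shrubs m)
     << ((-1) ^+ nchildren (tree_of T) / (alpha (tree_of T))%:R : rat)%:A *g T >>.

Definition TWmon (w : {fmonom posN}) : HGL K :=
  \prod_(i <- w : seq posN) TWcoef (val i).

Lemma TWmon_mmorphism : mmorphism TWmon.
Proof.
by split=> [u v|]; rewrite /TWmon ?fmM ?big_cat // fm1 big_nil.
Qed.
HB.instance Definition _ :=
  isMultiplicative.Build {fmonom posN} (HGL K) TWmon TWmon_mmorphism.

(* The algebra homomorphism T_W, determined by TW_Lambda; see TW_unique. *)
Definition TW : NSym K -> HGL K := mmap (in_alg (HGL K)) TWmon.
HB.instance Definition _ := GRing.Additive.on TW.

Lemma TW_monoid_morphism : monoid_morphism TW.
Proof.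
have [] := @commr_mmap_is_multiplicative _ _ _ (in_alg (HGL K)) TWmon.
  by move=> g m m'; rewrite /GRing.comm /= mulr_algl mulr_algr.
by [].
Qed.
HB.instance Definition _ := GRing.isMonoidMorphism.Build _ _ TW TW_monoid_morphism.

Lemma TW_scalable : scalable TW.
Proof. by move=> a x; rewrite /TW mmapZ /= mulr_algl. Qed.
HB.instance Definition _ := GRing.isScalable.Build _ _ _ _ TW TW_scalable.

Lemma TWcoef0 : TWcoef 0 = 1.
Proof.
have s0 T : (T \in shrubs 0) = (T == cls btree0).
  rewrite mem_shrubs; apply/andP/eqP => [[_ /eqP w0]|->].
    have V0 (x : 'I_(nv T)) : False.
      move/eqP: w0; rewrite /weight sum_nat_eq0 => /forallP/(_ x)/=.
      by apply/negP; rewrite -lt0n; apply: (valP (lab (tree_of T) x)).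
    rewrite -[LHS]tree_ofK; apply/cls_eqP/isoP.
    exists (fun x => match V0 x with end), (fun x : void => match x with end).
    by split=> [x|[]|x|x]; case: (V0 x).
  rewrite (is_shrub_iso (iso_tree_of_cls _)) (weight_iso (iso_tree_of_cls _)).
  rewrite /weight big1 => [|[]] //; split=> //; by apply/forallP=> -[].
have s0_perm : perm_eq (shrubs 0) [:: cls btree0].
  by apply: uniq_perm; rewrite ?undup_uniq // => T; rewrite s0 inE.
rewrite /TWcoef (perm_big _ s0_perm) big_seq1.
rewrite (nchildren_iso (iso_tree_of_cls _)).
rewrite (alpha_iso (iso_tree_of_cls _)).
have -> : nchildren btree0 = 0%N by apply: eq_card0 => -[].
have -> : alpha btree0 = 1%N.
  apply/eqP/cards1P; exists 1%g; apply/setP=> s; rewrite !inE.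
  have -> : s = 1%g by apply/permP=> -[].
  by rewrite eqxx; apply/forallP=> -[].
by rewrite expr0 divr1 scale1r.
Qed.

Lemma TW_Lambda m : TW (Lambda K m) = TWcoef m.
Proof.
rewrite /Lambda; case: insubP => [i _ <-|].
  rewrite /TW mmapU /= scale1r mul1r /TWmon.
  by rewrite (fmU i) big_seq1.
by rewrite -eqn0Ngt => /eqP ->; rewrite rmorph1 TWcoef0.
Qed.

Lemma TW_unique (phi : {lrmorphism NSym K -> HGL K}) :
  (forall m, phi (Lambda K m) = TWcoef m) -> phi =1 TW.
Proof.
move=> phiL x; rewrite [x]monalgE !raddf_sum; apply: eq_bigr => w _.
have -> : << x@_w *g w >> = x@_w *: \prod_(i <- w : seq posN) Lambda K (val i)
   :> NSym K.
  rewrite malgU_scale.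
  congr (_ *: _); case: w => s; elim: s => [|i s IH].
    rewrite big_nil; apply: (congr1 (fun v => << v >>)).
    by apply/eqP; rewrite fmP fm1.
  rewrite big_cons -IH /Lambda valK malgME !msuppU oner_eq0.
  rewrite !big_seq_fset1 !mcoeffUU mulr1; congr << _ >>.
  by apply/eqP; rewrite fmP fmM fmU.
rewrite /= [LHS]linearZ [RHS]linearZ !rmorph_prod /=; congr (_ *: _); apply: eq_bigr => i _.
by rewrite phiL TW_Lambda.
Qed.

End TW.

Arguments TW : clear implicits.

(* Main.v *)
Require Import Defs.
From mathcomp Require Import all_boot all_order all_algebra.
From mathcomp Require Import perm finmap.
From mathcomp.multinomials Require Import monalg.

(* Let L_s be the ladder (a path hanging from the root) whose labels, read from
   the leaf up to the root, form the word s. If T is a nonempty shrub, every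
   vertex of T is a leaf of every tree occurring in T . U, whereas a ladder has
   only one leaf. Hence L_(b :: s) occurs in T . U only if T is the one-vertex
   tree labeled b and U = L_s, and it then occurs once. Inductively, the
   coefficient of L_s in T_W(Lambda_w1 ... Lambda_wk) is (-1)^k if w = s and 0
   otherwise, so that T_W(x) determines all the coefficients of x. *)

Set Implicit Arguments.
Unset Strict Implicit.
Unset Printing Implicit Defensive.

Import GRing.Theory.
Local Open Scope ring_scope.

(** * Ladders and their parent functions *)

Definition single (b : posN) : btree unit := shrub [ffun=> b].

Fixpoint ladder_vertex (s : seq posN) : finType :=
  if s is _ :: s' then (unit + ladder_vertex s')%type else void.

(** For the empty word the bottom is the root [None]; the option type is also that of the targets of
    a grafting. *)
Definition bottom (s : seq posN) : option (ladder_vertex s) :=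
  if s is _ :: _ then Some (inl tt) else None.

Fixpoint ladder (s : seq posN) : btree (ladder_vertex s) :=
  if s is b :: s' then graft (T := single b) (ladder s') [ffun=> bottom s']
  else btree0.

Lemma up_single b x : up (single b) x = None.
Proof. by rewrite /up /= ffunE. Qed.

Lemma is_shrub_single b : is_shrub (single b).
Proof. by apply/forallP=> x; rewrite up_single. Qed.

Lemma lab_single b x : lab (single b) x = b.
Proof. by rewrite /lab /= ffunE. Qed.

Lemma attach_shrub (V V' : finType) (T : btree V)
    (f : {ffun top T -> option V'}) x (xT : up T x == None) :
  attach f x = f (exist _ x xT).
Proof. by rewrite /attach insubT. Qed.

Lemma up_graft_inl (V V' : finType) (T : btree V) (S : btree V')
    (f : {ffun top T -> option V'}) x (xT : up T x == None) :
  up (graft S f) (inl x) = omap inr (f (exist _ x xT)).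
Proof. by rewrite graft_upE /= (eqP xT) (attach_shrub _ xT). Qed.

(** The vertices of a shrub have no children in it, and the edges added by grafting lead to [S] or
    to its root. *)
Lemma up_graft_shrub (V V' : finType) (T : btree V) (S : btree V')
    (f : {ffun top T -> option V'}) z x :
  is_shrub T -> up (graft S f) z <> Some (inl x).
Proof.
move=> /forallP sT; case: z => [y|y]; last by rewrite graft_upE /=; case: (up S y).
by rewrite up_graft_inl; case: (f _).
Qed.

Lemma up_ladder_inl b s u :
  up (ladder (b :: s)) (inl u) = omap inr (bottom s).
Proof. by rewrite [ladder _]/= up_graft_inl ?up_single // => e; rewrite ffunE. Qed.

Lemma up_ladder_inr b s y :
  up (ladder (b :: s)) (inr y) = omap inr (up (ladder s) y).
Proof. by rewrite graft_upE. Qed.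

Lemma lab_ladder_inr b s y :
  lab (ladder (b :: s)) (inr y) = lab (ladder s) y.
Proof. by rewrite graft_labE. Qed.

(** This makes the bottom the only possible leaf; [z] is an option so that the root is covered
    too. *)
Lemma ladder_cover s z : z = bottom s \/ exists y, up (ladder s) y = z.
Proof.
elim: s z => [|b s IH] [[]|]; try by left.
- by case; left.
- move=> y; right; have [e|[y' e]] := IH (Some y).
    by exists (inl tt); rewrite up_ladder_inl -e.
  by exists (inr y'); rewrite up_ladder_inr e.
right; have [e|[y' e]] := IH None.
  by exists (inl tt); rewrite up_ladder_inl -e.
by exists (inr y'); rewrite up_ladder_inr e.
Qed.

Lemma up_ladder_neq_bottom s y : up (ladder s) y <> bottom s.
Proof.
elim: s y => [[]|b s IH] y; apply: up_graft_shrub; exact: is_shrub_single.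
Qed.

Lemma omap_inr_inj (A B : Type) : injective (omap (@inr A B)).
Proof. by case=> [x|] [y|] // [->]. Qed.

(** A ladder does not branch, even at the root: the new vertex hangs from [bottom s], which had no
    child before. *)
Lemma up_ladder_inj s : injective (up (ladder s)).
Proof.
elim: s => [[]|b s IH] [[]|x] [[]|y] //;
  rewrite ?(up_ladder_inl, up_ladder_inr) => /omap_inr_inj e.
- by have := @up_ladder_neq_bottom s y; rewrite -e.
- by have := @up_ladder_neq_bottom s x; rewrite e.
- by rewrite (IH _ _ e).
Qed.

(** * Graftings of shrubs that yield a ladder *)

Lemma iso_up_inj (V V' : finType) (T : btree V) (T' : btree V') :
  iso T T' -> injective (up T') -> injective (up T).
Proof.
case/isoP=> f [g [fK gK fU _]] inj x y e.
by apply: (can_inj fK); apply: inj; rewrite !fU e.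
Qed.

(** An isomorphism sends every vertex of [T], a leaf of the graft, to the only leaf [inl tt] of the
    ladder. So [T], which is nonempty by its weight, has one vertex, and the rest of the isomorphism
    goes from [S] to [ladder s]. *)
Lemma iso_graft_ladder (V V' : finType) (T : btree V) (S : btree V')
    (f : {ffun top T -> option V'}) b s :
  is_shrub T -> (0 < weight T)%N -> iso (graft S f) (ladder (b :: s)) ->
  iso T (single b) /\ iso S (ladder s).
Proof.
move=> sT wT /isoP[h [k [hK kK hU hL]]].
have hl x : h (inl x) = inl tt.
  have [[//]|[y e]] := @ladder_cover (b :: s) (Some (h (inl x))).
  have := hU (k y); rewrite kK e => e'.
  have [] := @up_graft_shrub _ _ _ S f (k y) x sT.
  by case: (up _ _) e' => //= t [/(can_inj hK) ->].
have [x0 _|V0] := pickP (fun _ : V => true); last first.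
  by move: wT; rewrite /weight big_pred0.
have Vx x : x = x0.
  suff [->] : inl x = inl x0 :> V + V' by [].
  by apply: (can_inj hK); rewrite !hl.
(* The value [inl tt] is already taken at [inl x0]. *)
have hr y : {z | h (inr y) = inr z}.
  case e: (h (inr y)) => [[]|z]; last by exists z.
  by have := can_inj hK (etrans e (esym (hl x0))).
have kr z : {y | k (inr z) = inr y}.
  case e: (k (inr z)) => [x|y]; last by exists y.
  by have := kK (inr z); rewrite e hl.
split.
  apply/isoP; exists (fun=> tt), (fun=> x0); split=> [x|[]|x|x] //.
  - by rewrite up_single (eqP (forallP sT x)).
  - by have := hL (inl x); rewrite hl !graft_labE.
apply/isoP; exists (fun y => sval (hr y)), (fun z => sval (kr z)).
have hrE y : inr (sval (hr y)) = h (inr y) by case: (hr y).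
have krE z : inr (sval (kr z)) = k (inr z) by case: (kr z).
split=> [y|z|y|y].
- suff [] : inr (sval (kr (sval (hr y)))) = inr y :> V + V' by [].
  by rewrite krE hrE hK.
- suff [] : inr (sval (hr (sval (kr z)))) = inr z :> unit + ladder_vertex s by [].
  by rewrite hrE krE kK.
- apply: (@omap_inr_inj unit); rewrite -(up_ladder_inr b) hrE hU graft_upE /=.
  by case: (up S y) => //= z; rewrite hrE.
- by rewrite -(lab_ladder_inr b) hrE hL graft_labE.
Qed.

(** Attached anywhere but at the bottom, the new vertex would give its parent a second child. *)
Lemma graft_single_ladder b s
    (f : {ffun top (single b) -> option (ladder_vertex s)}) :
  iso (graft (ladder s) f) (ladder (b :: s)) = (f == [ffun=> bottom s]).
Proof.
apply/idP/eqP => [fI|->]; last exact: iso_refl.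
have inj := iso_up_inj fI (@up_ladder_inj _).
apply/ffunP=> -[x xT]; rewrite ffunE.
have [//|[y e]] := ladder_cover (f (exist _ x xT)).
suff: inl x = inr y :> unit + ladder_vertex s by [].
by apply: inj; rewrite up_graft_inl graft_upE /= e.
Qed.

(** * Coefficients of ladders in products of two trees *)

Section Coefficients.
Variable K : comNzRingType.
Implicit Types (T U : tbar) (s : seq posN).

Lemma mcoeff_glsum (V V' V'' : finType) (T : btree V) (S : btree V')
    (L : btree V'') :
  (glsum K T S)@_(cls L) = \sum_f (iso (graft (T := T) S f) L)%:R.
Proof.
rewrite /glsum raddf_sum /=; apply: eq_bigr => f _; rewrite mcoeffU.
by congr (_ %:R); congr nat_of_bool; apply/eqP/cls_eqP.
Qed.

Lemma mcoeff_glmulT_ladder0 T U :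
  (0 < weight (tree_of T))%N -> (glmulT K T U)@_(cls (ladder [::])) = 0.
Proof.
move=> wT; rewrite -[T]tree_ofK -[U]tree_ofK glmulT_cls mcoeff_glsum.
apply: big1 => f _; case: isoP => // -[h _].
(* [h] would send a vertex of [T] into the empty type of vertices of [ladder [::]]. *)
have [x _|V0] := pickP (fun _ : 'I_(nv T) => true); first by case: (h (inl x)).
by move: wT; rewrite /weight big_pred0.
Qed.

(** Both factors are forced by [iso_graft_ladder], and [graft_single_ladder] then leaves exactly one
    grafting. *)
Lemma mcoeff_glmulT_ladder T U b s :
  is_shrub (tree_of T) -> (0 < weight (tree_of T))%N ->
  (glmulT K T U)@_(cls (ladder (b :: s)))
    = ((T == cls (single b)) && (U == cls (ladder s)))%:R.
Proof.
move=> sT wT; case: andP => [[/eqP-> /eqP->]|TU].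
  rewrite glmulT_cls mcoeff_glsum (bigD1 [ffun=> bottom s]) //= iso_refl big1.
    by rewrite addr0.
  by move=> f /negbTE fs; rewrite [iso _ _]graft_single_ladder fs.
rewrite -[T]tree_ofK -[U]tree_ofK glmulT_cls mcoeff_glsum big1 // => f _.
case: (boolP (iso _ _)) => // /(iso_graft_ladder sT wT)[Tb Us]; case: TU.
by split; apply/eqP; rewrite -[LHS]tree_ofK; apply/cls_eqP.
Qed.

End Coefficients.

(** * Coefficients of ladders in the image of [TW] *)

Section TWCoefficients.
Variable K : comAlgType rat.

Lemma weight_single b : weight (single b) = val b.
Proof. by rewrite /weight (big_pred1 tt) => [|[]] //=; rewrite lab_single. Qed.

Lemma nchildren_single b : nchildren (single b) = 1%N.
Proof.
rewrite /nchildren -[RHS]card_unit; apply: eq_card => x.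
by rewrite inE up_single.
Qed.

Lemma alpha_single b : alpha (single b) = 1%N.
Proof.
apply/eqP/cards1P; exists 1%g; apply/setP=> s; rewrite !inE.
have -> : s = 1%g by apply/permP=> -[]; case: (s tt); rewrite perm1.
by rewrite eqxx; apply/forallP=> x; rewrite !up_single !lab_single !eqxx.
Qed.

Lemma mem_single_shrubs b m : (cls (single b) \in shrubs m) = (val b == m).
Proof.
rewrite mem_shrubs (is_shrub_iso (iso_tree_of_cls _)) is_shrub_single.
by rewrite (weight_iso (iso_tree_of_cls _)) weight_single.
Qed.

Lemma TWcoef_mul_basis (a : posN) U :
  TWcoef K (val a) * << U >> = \sum_(T <- shrubs (val a))
    ((-1) ^+ nchildren (tree_of T) / (alpha (tree_of T))%:R : rat)%:A
       *: (glmulT K T U : HGL K).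
Proof.
rewrite mulr_suml; apply: eq_bigr => T _.
by rewrite malgU_scale -scalerAl; congr (_ *: _); apply: glmul_basis.
Qed.

Lemma shrubs_gt0 (a : posN) T : T \in shrubs (val a) ->
  is_shrub (tree_of T) /\ (0 < weight (tree_of T))%N.
Proof. by rewrite mem_shrubs => /andP[-> /eqP->]; split=> //; apply: valP. Qed.

Lemma mcoeff_TWcoefM0 (a : posN) (y : HGL K) :
  (TWcoef K (val a) * y)@_(cls (ladder [::])) = 0.
Proof.
elim/HGL_ind: y => [|c x y IHx IHy|U].
- by rewrite mulr0 mcoeff0.
- by rewrite mulrDr -scalerAr mcoeffD mcoeffZ IHx IHy mulr0 addr0.
rewrite TWcoef_mul_basis raddf_sum big_seq big1 //= => T /shrubs_gt0[_ wT].
by rewrite mcoeffZ mcoeff_glmulT_ladder0 // mulr0.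
Qed.

(** By linearity [y] may be a tree, and then only the shrub [single b] can contribute. Its
    coefficient is -1, since its root has one child and its only automorphism is the identity. *)
Lemma mcoeff_TWcoefM (a b : posN) s (y : HGL K) :
  (TWcoef K (val a) * y)@_(cls (ladder (b :: s)))
    = - ((a == b)%:R * y@_(cls (ladder s))).
Proof.
elim/HGL_ind: y => [|c x y IHx IHy|U].
- by rewrite mulr0 !mcoeff0 mulr0 oppr0.
- rewrite mulrDr -scalerAr !mcoeffD !mcoeffZ IHx IHy mulrDr opprD mulrN.
  by rewrite mulrCA.
rewrite TWcoef_mul_basis raddf_sum /= mcoeffU big_seq.
under eq_bigr => T /shrubs_gt0[sT wT] do
  rewrite mcoeffZ mcoeff_glmulT_ladder //.
rewrite -big_seq; have [->|ab] := eqVneq a b; last first.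
  (* Here [single b] has the wrong weight to be in [shrubs (val a)]. *)
  rewrite mul0r oppr0 big_seq big1 // => T Ta; case: eqP => [Tb|_]; last by rewrite mulr0.
  by move: Ta; rewrite Tb mem_single_shrubs eq_sym val_eqE (negbTE ab).
rewrite (bigD1_seq (cls (single b))) ?undup_uniq ?mem_single_shrubs //=.
rewrite eqxx big1 => [|T /negbTE->]; last by rewrite mulr0.
rewrite addr0 mul1r /=.
rewrite (nchildren_iso (iso_tree_of_cls _)) (alpha_iso (iso_tree_of_cls _)).
rewrite nchildren_single alpha_single expr1 divr1 scaleN1r.
by rewrite mulN1r.
Qed.

(** Each leftmost factor compares the first letters of [w] and [s], removes them and contributes a
    sign. *)
Lemma mcoeff_TWmon_ladder (w : seq posN) s :
  (\prod_(i <- w) TWcoef K (val i))@_(cls (ladder s))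
    = (-1) ^+ size w * (w == s)%:R.
Proof.
elim: w s => [|a w IH] [|b s]; rewrite ?big_nil ?big_cons.
- by rewrite expr0 mul1r mcoeffU !eqxx.
(* The empty product is the root alone, whereas this ladder has another vertex. *)
- rewrite mulr0 mcoeffU; case: eqP => // /cls_eqP/isoP[_ [g _]].
  by case: (g (inl tt)).
- by rewrite mcoeff_TWcoefM0 mulr0.
rewrite mcoeff_TWcoefM IH eqseq_cons exprS mulN1r mulNr mulrCA.
by case: (a == b); rewrite ?mul1r ?mul0r ?mulr0.
Qed.

Lemma mcoeff_TW_ladder (x : NSym K) (w : {fmonom posN}) :
  (TW K x)@_(cls (ladder w)) = (-1) ^+ size w * x@_w.
Proof.
have -> : TW K x = \sum_(v <- msupp x) x@_v *: TWmon K v.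
  by rewrite /TW /mmap; apply: eq_bigr => v _; rewrite /= mulr_algl.
rewrite raddf_sum /= [x in RHS]monalgE raddf_sum /= mulr_sumr.
apply: eq_bigr => v _; rewrite mcoeffZ mcoeff_TWmon_ladder mcoeffU -fmP.
case: eqP => [->|_]; first by rewrite mulr1 mulrC.
by rewrite !mulr0.
Qed.

End TWCoefficients.

Theorem theorem5p1 (K : comAlgType rat) : injective (TW K).
Proof.
(* Multiplication by the sign is an involution, so it suffices to compare the signed
   coefficients. *)
move=> x y xy; apply/malgP=> w; apply: (can_inj (signrMK (size w))).
by rewrite -!mcoeff_TW_ladder xy.
Qed.
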